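(* Let $E,F\in\mathbb C^{n\times m}$ and let $P(s)=sE-F$ be a matrix pencil with Weyr characteristic $w(P)=(w,a,b,c)$. Let $(W,A,B,C)$ be the Weyr characteristic of the linear relation $E^{-1}F:=\{(x,y)\in\mathbb C^m\times\mathbb C^m : Fx=Ey\}$ in $\mathbb C^m$ (the kernel representation of $P$). Then $$W=w,\qquad A=a,\qquad B=b.$$ Moreover, if $c=(c_1,\ldots,c_{n_c})$, then $C=(c_3,\ldots,c_{n_c})$ (the empty sequence if $n_c\le 2$).
   Context: **Linear relations.** A linear relation in a finite-dimensional complex vector space $X$ is a linear subspace $S$ of $X\times X$. Put $\operatorname{dom}S=\{x:(x,y)\in S \text{ for some }y\}$, $R(S)=\{y:(x,y)\in S\text{ for some }x\}$, $N(S)=\{x:(x,0)\in S\}$, $\operatorname{mul}(S)=\{y:(0,y)\in S\}$, $S-\lambda=\{(x,y-\lambda x):(x,y)\in S\}$ for $\lambda\in\mathbb C$. The product is $S_1S_2=\{(x,z): (x,y)\in S_2,\ (y,z)\in S_1\text{ for some }y\}$; $S^0=I$ is the identity relation and $S^k=S\cdot S^{k-1}$. For $\lambda\in\mathbb C$ let $\mathcal R_\lambda(S)=\bigcup_{k}N((S-\lambda)^k)$, $\mathcal R_\infty(S)=\bigcup_k\operatorname{mul}(S^k)$, and $\mathcal R_c(S)=\mathcal R_0(S)\cap\mathcal R_\infty(S)$. A number $\lambda\in\mathbb C$ is an eigenvalue of $S$ if $N(S-\lambda)\ne\{0\}$, and $\infty$ is an eigenvalue if $\operatorname{mul}(S)\neq\{0\}$;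 an eigenvalue $\lambda\in\mathbb C\cup\{\infty\}$ is proper if $\mathcal R_\lambda(S)\not\subset\mathcal R_c(S)$. **Weyr characteristic of a linear relation.** For $k\ge1$ and $\lambda\in\mathbb C$ set $$W_k(S,\lambda)=\dim\frac{N((S-\lambda)^k)+\mathcal R_c(S)}{N((S-\lambda)^{k-1})+\mathcal R_c(S)},\quad A_k=\dim\frac{\operatorname{mul}(S^k)+\mathcal R_c(S)}{\operatorname{mul}(S^{k-1})+\mathcal R_c(S)},\quad B_k=\dim\frac{N(S^k)\cap\mathcal R_c(S)}{N(S^{k-1})\cap\mathcal R_c(S)},$$ $$C_1=\dim\frac{R(S)+\operatorname{dom}S}{R(S)+\mathcal R_0(S)},\qquad C_k=\dim\frac{R(S^{k})+\mathcal R_0(S)}{R(S^{k+1})+\mathcal R_0(S)}\quad(k\ge2).$$ These sequences are non-increasing and eventually zero; they are regarded as finite sequences by omitting zero entries (possibly empty). $W$ is the collection of the sequences $W(\lambda)=(W_k(S,\lambda))_k$ indexed by the finite proper eigenvalues $\lambda$ of $S$, and $(W,A,B,C)$ with $A=(A_k)$, $B=(B_k)$, $C=(C_k)$ is the Weyr characteristic of $S$. **Weyr characteristic of a pencil.** For $k\ge1$ let $N_k\in\mathbb C^{k\times k}$ have ones on the first subdiagonal and zeros elsewhere, and let $K_k=[I_{k-1}\ 0]$, $L_k=[0\ I_{k-1}]\in\mathbb C^{(k-1)\times k}$ (for $k=1$ these are $0\times1$ matrices, contributing just a zero column to a block diagonal matrix, and their transposes contribute just a zero row). For a multi-index $\alpha=(\alpha_1,\dots,\alpha_l)$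 of positive integers, $|\alpha|=\sum_i\alpha_i$ and $N_\alpha,K_\alpha,L_\alpha$ are the block diagonal matrices with blocks $N_{\alpha_i},K_{\alpha_i},L_{\alpha_i}$. Every pencil $sE-F$ with $E,F\in\mathbb C^{n\times m}$ admits invertible $V\in\mathbb C^{n\times n}$, $U\in\mathbb C^{m\times m}$ with $$V(sE-F)U=\operatorname{diag}\big(sI_{n_0}-J_0,\ sN_\alpha-I_{|\alpha|},\ sK_\beta-L_\beta,\ sK_\gamma^\top-L_\gamma^\top\big)$$ (Kronecker canonical form), where $J_0$ is in Jordan normal form and $\alpha,\beta,\gamma$ are non-increasing multi-indices (any block may be absent), unique up to permutation of the Jordan blocks of $J_0$. The Weyr characteristic $w(P)=(w,a,b,c)$ is: $w$ is the collection, indexed by the eigenvalues $\lambda$ of $J_0$, of the sequences $w(\lambda)=(w_k(\lambda))_k$, $w_k(\lambda)=\dim N((J_0-\lambda)^k)-\dim N((J_0-\lambda)^{k-1})$; $a,b,c$ are the conjugate partitions of $\alpha,\beta,\gamma$, i.e. $a_k=\#\{i:\alpha_i\ge k\}$, and similarly for $b,c$ (zero entries omitted). The equality $W=w$ means that the finite proper eigenvalues of the relation are the eigenvalues of $J_0$ and that the sequences at each of them agree. *)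

(* Defs.v *)
From HB Require Import structures.
From mathcomp Require Import all_boot all_order all_algebra.
From mathcomp Require Import boolp classical_sets reals.
From mathcomp.real_closed Require Export complex.

Set Implicit Arguments.
Unset Strict Implicit.
Unset Printing Implicit Defensive.

Import GRing.Theory.

Local Open Scope classical_set_scope.
Local Open Scope ring_scope.

Section Subspaces.
Variables (K : fieldType) (V : vectType K).
Implicit Types (P : set V) (U W : {vspace V}).

(* The [{vspace V}] whose elements are exactly those of [P]; it exists as soon
   as [P] is a linear subspace ([mem_vs_of]), and is the null space otherwise. *)
Definition vs_of P : {vspace V} := xget 0%VS [set U : {vspace V} | [set` U] = P].

Lemma mem_vs_of P :
    P 0 -> (forall (a : K) u v, P u -> P v -> P (a *: u + v)) ->
  forall x, x \in vs_of P <-> P x.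
Proof.
move=> P0 Plin.
suff [U UP] : exists U : {vspace V}, [set` U] = P.
  have := @xgetPex _ 0%VS [set U : {vspace V} | [set` U] = P] (ex_intro _ U UP).
  by rewrite -/(vs_of P) /= => eqP x; rewrite -[in P x]eqP.
have sub n : (exists U, [set` U] = P) \/
    exists2 U : {vspace V}, forall x, x \in U -> P x & (n <= \dim U)%N.
  elim: n => [|n [|[U UP nU]]]; [right | by left | ].
    by exists 0%VS => // x; rewrite memv0 => /eqP ->.
  case: (pselect (forall x, P x -> x \in U)) => [PU|].
    by left; exists U; apply/seteqP; split => x /=; [apply: UP | apply: PU].
  move=> /existsNP [x /not_implyP [Px /negP xU]].
  right; exists (<[x]> + U)%VS.
    move=> y /memv_addP [u /vlineP [k ->] [v /UP Pv ->]].
    exact: Plin.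
  apply: (leq_ltn_trans nU).
  rewrite ltn_neqAle dimvS ?addvSr // andbT.
  apply: contra xU => /eqP dimE.
  have := dimv_leqif_sup (addvSr <[x]> U) => -[_].
  rewrite dimE eqxx => /esym/subvP; apply.
  by rewrite -[x]addr0; apply: memv_add; rewrite ?addr0 ?memv_line ?mem0v.
have [//|[U _]] := sub (\dim {:V}).+1.
by rewrite ltnNge dimvS ?subvf.
Qed.

(* [dim (U / W)] for [W <= U]: there are no quotients of [{vspace V}], but
   [U :\: W] is a complement of [W] in [U]. *)
Definition dim_quot U W : nat := \dim (U :\: W).

Lemma dim_quotE U W : (W <= U)%VS -> dim_quot U W = (\dim U - \dim W)%N.
Proof.
move=> WU; rewrite /dim_quot -(dimv_cap_compl U W).
by move/capv_idPr: WU => ->; rewrite addKn.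
Qed.

End Subspaces.

Section FiniteSequences.
Implicit Types f : nat -> nat.

(* The finite sequence obtained from the eventually zero sequence
   [f 1, f 2, ...] by omitting its zero entries. *)
Definition omit_zeros f : seq nat :=
  xget [::] [set s | exists n0, forall n, (n0 <= n)%N ->
                       s = [seq x <- [seq f k | k <- iota 1 n] | x != 0%N]].

Lemma omit_zerosE f n : (forall k, (n < k)%N -> f k = 0%N) ->
  omit_zeros f = [seq x <- [seq f k | k <- iota 1 n] | x != 0%N].
Proof.
move=> f0.
have tail n1 : (n <= n1)%N -> [seq x <- [seq f k | k <- iota 1 n1] | x != 0%N]
    = [seq x <- [seq f k | k <- iota 1 n] | x != 0%N].
  move=> /subnKC <-; rewrite iotaD map_cat filter_cat.
  rewrite [X in _ ++ X](_ : _ = [::]) ?cats0 //.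
  rewrite -(filter_pred0 [seq f k | k <- iota (1 + n) (n1 - n)]).
  apply: eq_in_filter => _ /mapP [k + ->].
  by rewrite mem_iota add1n => /andP [/f0 -> _].
rewrite /omit_zeros; case: xgetP => [_ -> [n0 /(_ _ (leq_maxl n0 n)) ->]|].
  exact/tail/leq_maxr.
case/(_ [seq x <- [seq f k | k <- iota 1 n] | x != 0%N]).
by exists n => n1 /tail.
Qed.

End FiniteSequences.

Section LinearRelations.
Variables (K : fieldType) (X : vectType K).
Implicit Types (S T : {vspace (X * X)}) (lam : K) (x y z : X) (k : nat).

Definition rdom S : {vspace X} := vs_of [set x | exists y, (x, y) \in S].
Definition rran S : {vspace X} := vs_of [set y | exists x, (x, y) \in S].
Definition rker S : {vspace X} := vs_of [set x | (x, 0) \in S].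
Definition rmul S : {vspace X} := vs_of [set y | (0, y) \in S].

Definition rshift S lam : {vspace (X * X)} :=
  vs_of [set (p.1, p.2 - lam *: p.1) | p in [set` S]].

Definition rid : {vspace (X * X)} := vs_of [set (x, x) | x in [set: X]].

Definition rcomp S T : {vspace (X * X)} :=
  vs_of [set p | exists y, (p.1, y) \in T /\ (y, p.2) \in S].

Fixpoint rpow S k : {vspace (X * X)} :=
  if k is k'.+1 then rcomp S (rpow S k') else rid.

(* [R_lam(S)], [R_oo(S)] and [R_c(S)] *)
Definition root_space S lam : {vspace X} :=
  vs_of (\bigcup_k [set` rker (rpow (rshift S lam) k)]).
Definition root_space_inf S : {vspace X} :=
  vs_of (\bigcup_k [set` rmul (rpow S k)]).
Definition sing_chain_space S : {vspace X} :=
  (root_space S 0 :&: root_space_inf S)%VS.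

Definition rel_eigenvalue S lam : Prop := rker (rshift S lam) <> 0%VS.
Definition proper_eigenvalue S lam : Prop :=
  rel_eigenvalue S lam /\ ~~ (root_space S lam <= sing_chain_space S)%VS.

Definition Weyr_W S lam k : nat :=
  dim_quot (rker (rpow (rshift S lam) k) + sing_chain_space S)%VS
           (rker (rpow (rshift S lam) k.-1) + sing_chain_space S)%VS.
Definition Weyr_A S k : nat :=
  dim_quot (rmul (rpow S k) + sing_chain_space S)%VS
           (rmul (rpow S k.-1) + sing_chain_space S)%VS.
Definition Weyr_B S k : nat :=
  dim_quot (rker (rpow S k) :&: sing_chain_space S)%VS
           (rker (rpow S k.-1) :&: sing_chain_space S)%VS.
Definition Weyr_C S k : nat :=
  if k == 1%N then dim_quot (rran S + rdom S)%VS (rran S + root_space S 0)%VS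
  else dim_quot (rran (rpow S k) + root_space S 0)%VS
                (rran (rpow S k.+1) + root_space S 0)%VS.

(* A collection of sequences indexed by a subset of [K] is encoded as a partial
   function: [None] off the index set. *)
Definition relation_W S : K -> option (seq nat) := fun lam =>
  if `[< proper_eigenvalue S lam >] then Some (omit_zeros (Weyr_W S lam))
  else None.
Definition relation_A S : seq nat := omit_zeros (Weyr_A S).
Definition relation_B S : seq nat := omit_zeros (Weyr_B S).
Definition relation_C S : seq nat := omit_zeros (Weyr_C S).

Let memP S (a : K) x y x' y' :
  (x, y) \in S -> (x', y') \in S -> (a *: x + x', a *: y + y') \in S.
Proof. by move=> xyS xyS'; exact: (memvD (memvZ a xyS) xyS'). Qed.

Let mem0 S : (0, 0) \in S.
Proof. exact: mem0v. Qed.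

Lemma mem_rdom S x : x \in rdom S <-> exists y, (x, y) \in S.
Proof.
apply: mem_vs_of => [|a u v [y uS] [z vS]]; first by exists 0.
by exists (a *: y + z); apply: memP.
Qed.

Lemma mem_rran S y : y \in rran S <-> exists x, (x, y) \in S.
Proof.
apply: mem_vs_of => [|a u v [y' uS] [z vS]]; first by exists 0.
by exists (a *: y' + z); apply: memP.
Qed.

Lemma mem_rker S x : x \in rker S <-> (x, 0) \in S.
Proof.
apply: (mem_vs_of (P := [set x | (x, 0) \in S])) => //= a u v uS vS.
by have := memP a uS vS; rewrite scaler0 addr0.
Qed.

Lemma mem_rmul S y : y \in rmul S <-> (0, y) \in S.
Proof.
apply: (mem_vs_of (P := [set y | (0, y) \in S])) => //= a u v uS vS.
by have := memP a uS vS; rewrite scaler0 addr0.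
Qed.

Lemma mem_rshift S lam x z :
  (x, z) \in rshift S lam <-> exists2 y, (x, y) \in S & z = y - lam *: x.
Proof.
rewrite mem_vs_of.
- split=> [[[x' y] /= xyS [<- <-]]|[y xyS ->]]; [by exists y | by exists (x, y)].
- by exists (0, 0); rewrite /= ?scaler0 ?subr0.
move=> a _ _ [[u1 u2] /= uS <-] [[v1 v2] /= vS <-].
exists (a *: u1 + v1, a *: u2 + v2); first exact: memP.
congr (_, _) => /=.
rewrite scalerBr !scalerDr !scalerA [lam * a]mulrC opprD -!addrA.
by congr (_ + _); rewrite addrCA.
Qed.

Lemma mem_rid x y : (x, y) \in rid <-> x = y.
Proof.
rewrite mem_vs_of; last 2 first.
- by exists 0.
- by move=> a _ _ [u _ <-] [v _ <-]; exists (a *: u + v).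
by split=> [[z _ [<- <-]]|->] //; exists y.
Qed.

Lemma mem_rcomp S T x z :
  (x, z) \in rcomp S T <-> exists y, (x, y) \in T /\ (y, z) \in S.
Proof.
rewrite mem_vs_of //; first by exists 0.
move=> a [u1 u2] [v1 v2] /= [y [uT uS]] [y' [vT vS]].
by exists (a *: y + y'); split; apply: memP.
Qed.

Lemma sub_rker_rpow S k l :
  (k <= l)%N -> (rker (rpow S k) <= rker (rpow S l))%VS.
Proof.
move=> /subnK <-; elim: (l - k)%N => //= n IH; apply/(subv_trans IH)/subvP => x.
by rewrite !mem_rker => xS; apply/mem_rcomp; exists 0.
Qed.

Lemma rpowSr S k x z :
  (x, z) \in rpow S k.+1 <-> exists y, (x, y) \in S /\ (y, z) \in rpow S k.
Proof.
elim: k z => [|k IH] z.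
  rewrite /= mem_rcomp; split=> [[y [/mem_rid -> xyS]]|[y [xyS /mem_rid <-]]].
    by exists z; rewrite mem_rid.
  by exists x; rewrite mem_rid.
rewrite /= mem_rcomp; split=> [[y [/IH [t [xt ty]] yz]]|[y [xy /mem_rcomp]]].
  by exists t; split=> //; apply/mem_rcomp; exists y.
by move=> [t [yt tz]]; exists t; split=> //; apply/IH; exists y.
Qed.

Lemma sub_rmul_rpow S k l :
  (k <= l)%N -> (rmul (rpow S k) <= rmul (rpow S l))%VS.
Proof.
move=> /subnK <-; elim: (l - k)%N => // n IH; apply/(subv_trans IH)/subvP => x.
by rewrite !mem_rmul addSn rpowSr => xS; exists 0.
Qed.

Lemma sub_rran_rpow S k l :
  (k <= l)%N -> (rran (rpow S l) <= rran (rpow S k))%VS.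
Proof.
move=> /subnK <-; elim: (l - k)%N => // n IH; apply/subv_trans/IH/subvP => x.
by rewrite !mem_rran => -[y /rpowSr [z [_ zx]]]; exists z.
Qed.

Let mem_cup (U : nat -> {vspace X}) x :
    (forall k l, (k <= l)%N -> (U k <= U l)%VS) ->
  x \in vs_of (\bigcup_k [set` U k]) <-> exists k, x \in U k.
Proof.
move=> Ule; rewrite mem_vs_of.
- by split=> [[k _ xk]|[k xk]]; exists k.
- by exists 0%N => //=; apply: mem0v.
move=> a u v [k _ /= uk] [l _ /= vl]; exists (maxn k l) => //=.
rewrite memvD ?memvZ //.
  exact: (subvP (Ule _ _ (leq_maxl k l))).
exact: (subvP (Ule _ _ (leq_maxr k l))).
Qed.

Lemma mem_root_space S lam x :
  x \in root_space S lam <-> exists k, x \in rker (rpow (rshift S lam) k).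
Proof. by apply: mem_cup => k l; apply: sub_rker_rpow. Qed.

Lemma mem_root_space_inf S x :
  x \in root_space_inf S <-> exists k, x \in rmul (rpow S k).
Proof. by apply: mem_cup => k l; apply: sub_rmul_rpow. Qed.

Lemma chain_stable (U : nat -> {vspace X}) :
    (forall k l, (k <= l)%N -> (U k <= U l)%VS) \/
    (forall k l, (k <= l)%N -> (U l <= U k)%VS) ->
  exists n, forall k, (n <= k)%N -> U k = U n.
Proof.
have max (d : nat -> nat) b : (forall k, d k <= b)%N ->
    exists n, forall k, (d k <= d n)%N.
  move=> db; pose P (y : nat) := `[< exists k, d k = y >].
  have exP : exists j, P j by exists (d 0%N); apply/asboolP; exists 0%N.
  have Pb j : P j -> (j <= b)%N by move=> /asboolP [k <-].
  case: (ex_maxnP exP Pb) => _ /asboolP [n <-] dn.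
  by exists n => k; apply: dn; apply/asboolP; exists k.
case=> Ule.
  have [k|n dn] := max (fun k => \dim (U k)) (\dim {:X}).
    by rewrite dimvS ?subvf.
  by exists n => k nk; apply/esym/eqP; rewrite eqEdim Ule ?dn.
have [k|n dn] := max (fun k => \dim {:X} - \dim (U k))%N (\dim {:X}).
  exact: leq_subr.
exists n => k nk; apply/eqP; rewrite eqEdim Ule //=.
by move: (dn k); rewrite leq_sub2lE // dimvS ?subvf.
Qed.

Let stable0 (U : nat -> {vspace X}) (g : {vspace X} -> {vspace X}) :
    (exists n, forall k, (n <= k)%N -> U k = U n) ->
  exists n, forall k, (n < k)%N -> dim_quot (g (U k)) (g (U k.-1)) = 0%N.
Proof.
move=> [n Un]; exists n => -[//|k] nk.
by rewrite dim_quotE /= (Un k.+1) ?(Un k) ?subvv ?subnn // leqW.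
Qed.

Lemma Weyr_W_eventually0 S lam :
  exists n, forall k, (n < k)%N -> Weyr_W S lam k = 0%N.
Proof.
apply: (stable0 (U := fun k => rker (rpow (rshift S lam) k))
                (fun V => V + sing_chain_space S)%VS).
by apply: chain_stable; left=> k l; apply: sub_rker_rpow.
Qed.

Lemma Weyr_A_eventually0 S : exists n, forall k, (n < k)%N -> Weyr_A S k = 0%N.
Proof.
apply: (stable0 (U := fun k => rmul (rpow S k))
                (fun V => V + sing_chain_space S)%VS).
by apply: chain_stable; left=> k l; apply: sub_rmul_rpow.
Qed.

Lemma Weyr_B_eventually0 S : exists n, forall k, (n < k)%N -> Weyr_B S k = 0%N.
Proof.
apply: (stable0 (U := fun k => rker (rpow S k))
                (fun V => V :&: sing_chain_space S)%VS).
by apply: chain_stable; left=> k l; apply: sub_rker_rpow.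
Qed.

Lemma Weyr_C_eventually0 S : exists n, forall k, (n < k)%N -> Weyr_C S k = 0%N.
Proof.
have [|n Un] := @chain_stable (fun k => rran (rpow S k)).
  by right=> k l; apply: sub_rran_rpow.
exists n.+1 => k nk; rewrite /Weyr_C gtn_eqF ?(leq_ltn_trans _ nk) //.
have nk' := ltnW (ltnW nk).
by rewrite dim_quotE (Un k) ?(Un k.+1) ?subvv ?subnn // leqW.
Qed.

End LinearRelations.

Section BlockMatrices.
Variable K : fieldType.

Definition diag2_mx m1 n1 m2 n2 (A : 'M[K]_(m1, n1)) (B : 'M[K]_(m2, n2)) :
  'M[K]_(m1 + m2, n1 + n2) := block_mx A 0 0 B.

Fixpoint diag_blocks (T : Type) (f g : T -> nat)
    (B : forall t, 'M[K]_(f t, g t)) (s : seq T) :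
    'M[K]_(sumn [seq f t | t <- s], sumn [seq g t | t <- s]) :=
  if s is t :: s' then diag2_mx (B t) (diag_blocks B s') else 0.

Definition nilp_block k : 'M[K]_k := \matrix_(i, j) (i == j.+1 :> nat)%:R.
Definition K_block k : 'M[K]_(k.-1, k) := \matrix_(i, j) (j == i :> nat)%:R.
Definition L_block k : 'M[K]_(k.-1, k) := \matrix_(i, j) (j == i.+1 :> nat)%:R.
Definition jordan_block (p : K * nat) : 'M[K]_(p.2) :=
  p.1%:M + \matrix_(i, j) (j == i.+1 :> nat)%:R.

Definition nilp_mx (alpha : seq nat) := diag_blocks nilp_block alpha.
Definition K_mx (beta : seq nat) := diag_blocks K_block beta.
Definition L_mx (beta : seq nat) := diag_blocks L_block beta.

(* The Jordan matrix with blocks of eigenvalue [p.1] and size [p.2], [p \in js]. *)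
Definition jordan_mx (js : seq (K * nat)) := diag_blocks jordan_block js.

End BlockMatrices.

Section Pencils.
Variable K : fieldType.

Definition pencil n m (E F : 'M[K]_(n, m)) (s : K) : 'M[K]_(n, m) := s *: E - F.

Definition kronecker_rows (js : seq (K * nat)) (alpha beta gamma : seq nat) :=
  (sumn [seq p.2 | p <- js] + (sumn [seq k | k <- alpha] +
    (sumn [seq k.-1 | k <- beta] + sumn [seq k | k <- gamma])))%N.
Definition kronecker_cols (js : seq (K * nat)) (alpha beta gamma : seq nat) :=
  (sumn [seq p.2 | p <- js] + (sumn [seq k | k <- alpha] +
    (sumn [seq k | k <- beta] + sumn [seq k.-1 | k <- gamma])))%N.

(* For a block of size [k.+1] in [gamma] the transposed blocks are
   [k.+1] by [k]; a size of 1 gives a zero row. *)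
Definition kronecker_mx js alpha beta gamma (s : K) :
    'M[K]_(kronecker_rows js alpha beta gamma,
           kronecker_cols js alpha beta gamma) :=
  diag2_mx (s%:M - jordan_mx js)
 (diag2_mx (s *: nilp_mx K alpha - 1%:M)
 (diag2_mx (s *: K_mx K beta - L_mx K beta)
           (s *: (K_mx K gamma)^T - (L_mx K gamma)^T))).

Definition multi_index (alpha : seq nat) : bool :=
  all (fun k => 0 < k)%N alpha && sorted geq alpha.

Definition kronecker_form n m (E F : 'M[K]_(n, m))
    (js : seq (K * nat)) (alpha beta gamma : seq nat) : Prop :=
  [/\ all (fun p => 0 < p.2)%N js,
      multi_index alpha, multi_index beta, multi_index gamma &
      exists (en : n = kronecker_rows js alpha beta gamma)
             (em : m = kronecker_cols js alpha beta gamma)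
             (V : 'M[K]_n) (U : 'M[K]_m),
        [/\ V \in unitmx, U \in unitmx &
            forall s, castmx (en, em) (V *m pencil E F s *m U) =
                      kronecker_mx js alpha beta gamma s]].

Definition mx_ker n (M : 'M[K]_n) : {vspace 'cV[K]_n} :=
  vs_of [set x : 'cV[K]_n | M *m x = 0].

Definition matrix_w n (J : 'M[K]_n) : K -> option (seq nat) := fun lam =>
  if eigenvalue J lam then
    Some (omit_zeros (fun k => \dim (mx_ker ((J - lam%:M) ^+ k)) -
                               \dim (mx_ker ((J - lam%:M) ^+ k.-1)))%N)
  else None.

Definition conj_partition (alpha : seq nat) : seq nat :=
  omit_zeros (fun k => count (fun i => k <= i)%N alpha).

(* [(w, a, b, c)] is the Weyr characteristic of [sE - F]. *)
Definition pencil_Weyr n m (E F : 'M[K]_(n, m))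
    (w : K -> option (seq nat)) (a b c : seq nat) : Prop :=
  exists js alpha beta gamma,
    [/\ kronecker_form E F js alpha beta gamma,
        w = matrix_w (jordan_mx js), a = conj_partition alpha,
        b = conj_partition beta & c = conj_partition gamma].

Definition kernel_relation n m (E F : 'M[K]_(n, m)) :
    {vspace ('cV[K]_m * 'cV[K]_m)} :=
  vs_of [set p | F *m p.1 = E *m p.2].

Lemma mem_mx_ker n (M : 'M[K]_n) (x : 'cV[K]_n) : x \in mx_ker M <-> M *m x = 0.
Proof.
apply: (mem_vs_of (P := [set x : 'cV[K]_n | M *m x = 0])) => /=.
  exact: mulmx0.
by move=> a u v Mu Mv; rewrite mulmxDr -scalemxAr Mu Mv scaler0 addr0.
Qed.

Lemma mem_kernel_relation n m (E F : 'M[K]_(n, m)) (x y : 'cV[K]_m) :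
  (x, y) \in kernel_relation E F <-> F *m x = E *m y.
Proof.
rewrite mem_vs_of //=; first by rewrite !mulmx0.
by move=> a u v Pu Pv; rewrite !mulmxDr -!scalemxAr Pu Pv.
Qed.

Lemma matrix_w_eventually0 n (M : 'M[K]_n) :
  exists n0, forall k, (n0 < k)%N ->
    (\dim (mx_ker (M ^+ k)) - \dim (mx_ker (M ^+ k.-1)))%N = 0%N.
Proof.
have [|n0 Mn] := @chain_stable _ _ (fun k => mx_ker (M ^+ k)).
  left=> k l /subnK <-; elim: (l - k)%N => // j IH; apply/(subv_trans IH)/subvP.
  by move=> x; rewrite !mem_mx_ker addSn exprS -mulmxA => ->; rewrite mulmx0.
exists n0 => -[//|k] nk.
by rewrite /= (Mn k.+1) ?(Mn k) ?subnn // leqW.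
Qed.

Lemma count_eventually0 (alpha : seq nat) :
  exists n, forall k, (n < k)%N -> count (fun i => k <= i)%N alpha = 0%N.
Proof.
exists (sumn alpha) => k /ltP/ltP ltk; apply/eqP.
rewrite eqn0Ngt -has_count; apply/hasPn => i ia; rewrite -ltnNge.
apply: leq_ltn_trans ltk; elim: alpha ia => //= j alpha IH.
rewrite inE => /orP [/eqP ->|/IH ij]; first exact: leq_addr.
exact: (leq_trans ij (leq_addl _ _)).
Qed.

End Pencils.

(* Main.v *)
Require Import Defs.
From mathcomp Require Import all_boot all_order all_algebra.
From mathcomp Require Import boolp classical_sets reals.
From mathcomp.real_closed Require Import complex.
From mathcomp Require Import zify.

(** A change of basis takes the pencil to its Kronecker form without altering
    the relation [E^-1 F] up to isomorphism, and the kernel relation of a block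
    diagonal pencil is the direct sum of the kernel relations of its blocks.
    Domains, ranges, kernels, multivalued parts, powers, shifts and root spaces
    all split along a direct sum, so every entry of the sequences W, A, B, C is
    additive ([Weyr_dsum], [Weyr_diag2]).  It remains to look at one block of
    each kind.

    - For [s I - J] the relation is the graph of [J]; its root spaces are the
      generalized eigenspaces of [J], which gives W ([Weyr_jordan]).  It has no
      multivalued part, and its range sequence contributes nothing to C because
      the image of a power of [J] and the generalized kernel of [J] together
      span the whole space (Fitting).
    - For [s N_d - I] the relation is the inverse of the graph of a nilpotent
      shift.  It has no finite eigenvalue and it is onto, and the multivalued
      part of its k-th power is the kernel of [N_d ^ k], of dimension min(k, d):
      this adds 1 to [A_k] exactly when k <= d ([Weyr_nilp_block]).
    - For [s K_d - L_d] everything lies in the singular chain space, because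
      both the root space at 0 and that at infinity exhaust the space; the
      kernel of the k-th power has dimension min(k, d), which gives B
      ([Weyr_KL_block]).
    - For the transposed block of size g the relation is the shift along a chain
      of g - 1 vectors e_1 -> e_2 -> ... that cannot be continued past the last
      one.  Neither finite nor infinite eigenvalues occur, and the range of the
      k-th power has dimension max(g - 1 - k, 0).  For k = 1 domain and
      range together span the space as soon as g >= 3 and are null otherwise.
      So [C_k] counts the blocks with g >= k + 2 ([Weyr_trKL_block]): blocks of
      size 1 and 2 leave no trace, and [C_k = c_(k+2)].

    Summing over the blocks gives the sequences ([Weyr_kronecker]).  The index
    set of W is recovered from the numbers: an eigenvalue is proper exactly when
    some [W_k] is non-zero ([proper_eigenvalueP]), and likewise for the kernel
    dimensions of a matrix ([eigenvalue_kernel_dimsP]). *)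

Set Implicit Arguments.
Unset Strict Implicit.
Unset Printing Implicit Defensive.

Import GRing.Theory.

Local Open Scope ring_scope.

(** * Finite sequences without zero entries *)

Lemma omit_zeros_eq (f g : nat -> nat) :
  (forall k, (0 < k)%N -> f k = g k) -> omit_zeros f = omit_zeros g.
Proof.
move=> fg; rewrite /omit_zeros.
have fgE n : [seq f k | k <- iota 1 n] = [seq g k | k <- iota 1 n].
  by apply/eq_in_map => k; rewrite mem_iota => /andP [/fg].
congr (xget _ _); apply/seteqP.
by split=> s /= [n0 sE]; exists n0 => n /sE; rewrite fgE.
Qed.

(** Monotonicity is what makes shifting the index by two drop two entries: when
    [c 1] or [c 2] is zero, and hence omitted, all later entries vanish too. *)
Lemma omit_zeros_shift (c : nat -> nat) :
    (forall k l, (k <= l)%N -> (c l <= c k)%N) ->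
    (exists n, forall k, (n < k)%N -> c k = 0%N) ->
  omit_zeros (fun k => c k.+2) = drop 2 (omit_zeros c).
Proof.
move=> c_le [n c0].
rewrite (@omit_zerosE c n.+2) => [|k nk]; last by apply: c0; lia.
rewrite (@omit_zerosE (fun k => c k.+2) n) => [|k nk]; last by apply: c0; lia.
have -> : [seq c k | k <- iota 1 n.+2]
    = [:: c 1%N, c 2%N & [seq c k.+2 | k <- iota 1 n]].
  by rewrite /= (iotaDl 2 1) -map_comp.
have c0' (i : nat) : (i <= 3)%N -> c i = 0%N ->
    [seq x <- [seq c k.+2 | k <- iota 1 n] | x != 0%N] = [::].
  move=> i3 ci; apply/eqP; rewrite -[_ == _]negbK -has_filter -all_predC.
  apply/allP => _ /mapP [k + ->]; rewrite mem_iota /= negbK => kn.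
  by rewrite -leqn0 -ci c_le //; lia.
move=> /=; case: (c 1%N =P 0%N) => [c1|_] /=.
  by rewrite (c0' 1%N) //=; case: (_ == _).
case: (c 2%N =P 0%N) => [c2|_] /=; last by rewrite drop0.
by rewrite (c0' 2%N).
Qed.

(** * Direct sums of linear relations *)

Section DirectSum.
Variables (K : fieldType) (X1 X2 X : vectType K).
Variables (i1 : 'Hom(X1, X)) (i2 : 'Hom(X2, X)).
Hypothesis i_inj : forall x1 x2, i1 x1 + i2 x2 = 0 -> x1 = 0 /\ x2 = 0.
Hypothesis i_surj : forall x, exists x1 x2, x = i1 x1 + i2 x2.

(** [U] is the sum of its intersections with the two summands, which are the
    images of [U1] and [U2]. *)
Definition dsum_vs (U : {vspace X}) (U1 : {vspace X1}) (U2 : {vspace X2}) :=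
  forall x1 x2, i1 x1 + i2 x2 \in U <-> x1 \in U1 /\ x2 \in U2.

Definition dsum_rel (S : {vspace (X * X)}) (S1 : {vspace (X1 * X1)})
    (S2 : {vspace (X2 * X2)}) :=
  forall x1 x2 y1 y2, (i1 x1 + i2 x2, i1 y1 + i2 y2) \in S <->
                      (x1, y1) \in S1 /\ (x2, y2) \in S2.

Lemma dsum_inj x1 x2 y1 y2 :
  i1 x1 + i2 x2 = i1 y1 + i2 y2 -> x1 = y1 /\ x2 = y2.
Proof.
move=> /eqP; rewrite -subr_eq0 opprD addrACA -!linearB => /eqP /i_inj [].
by move=> /eqP + /eqP; rewrite !subr_eq0 => /eqP -> /eqP ->.
Qed.

Lemma dsum_add U U1 U2 W W1 W2 : dsum_vs U U1 U2 -> dsum_vs W W1 W2 ->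
  dsum_vs (U + W)%VS (U1 + W1)%VS (U2 + W2)%VS.
Proof.
move=> UE WE x1 x2; split.
  move=> /memv_addP [u uU [v vW]].
  have [u1 [u2 uE]] := i_surj u; have [v1 [v2 vE]] := i_surj v.
  move: uU vW; rewrite uE vE => /UE [u1U u2U] /WE [v1W v2W].
  rewrite addrACA -!linearD => /dsum_inj [-> ->].
  by split; apply: memv_add.
move=> [/memv_addP [u1 u1U [v1 v1W ->]] /memv_addP [u2 u2U [v2 v2W ->]]].
rewrite !linearD addrACA; apply: memv_add.
  exact/UE.
exact/WE.
Qed.

Lemma dsum_cap U U1 U2 W W1 W2 : dsum_vs U U1 U2 -> dsum_vs W W1 W2 ->
  dsum_vs (U :&: W)%VS (U1 :&: W1)%VS (U2 :&: W2)%VS.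
Proof.
move=> UE WE x1 x2; rewrite !memv_cap; split.
  by move=> /andP [/UE [-> ->] /WE [-> ->]].
by move=> [/andP [u1 w1] /andP [u2 w2]]; apply/andP; split; [apply/UE|apply/WE].
Qed.

Lemma dsum_dim U U1 U2 : dsum_vs U U1 U2 -> \dim U = (\dim U1 + \dim U2)%N.
Proof.
move=> UE.
have -> : U = (i1 @: U1 + i2 @: U2)%VS.
  apply/vspaceP => x; apply/idP/idP.
    have [x1 [x2 ->]] := i_surj x => /UE [x1U x2U].
    by rewrite memv_add ?memv_img.
  move=> /memv_addP [_ /memv_imgP [u1 ? ->] [_ /memv_imgP [u2 ? ->] ->]].
  exact/UE.
rewrite dimv_disjoint_sum; last first.
  apply/eqP; rewrite -subv0; apply/subvP => x.
  rewrite memv_cap => /andP [/memv_imgP [u1 _ ->] /memv_imgP [u2 _] /eqP].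
  rewrite -subr_eq0 -linearN => /eqP /i_inj [-> _].
  by rewrite linear0 mem0v.
congr (_ + _)%N; apply/limg_dim_eq/eqP; rewrite -subv0; apply/subvP => x;
  rewrite memv_cap memv_ker memv0 => /andP [_ /eqP ix].
  by have [|-> //] := @i_inj x 0; rewrite ix linear0 addr0.
by have [|_ -> //] := @i_inj 0 x; rewrite ix linear0 addr0.
Qed.

Lemma dsum_dim_quot U U1 U2 W W1 W2 : dsum_vs U U1 U2 -> dsum_vs W W1 W2 ->
  dim_quot U W = (dim_quot U1 W1 + dim_quot U2 W2)%N.
Proof.
move=> UE WE; have := dsum_dim (dsum_cap UE WE); have := dsum_dim UE.
have := dimv_cap_compl U W; have := dimv_cap_compl U1 W1.
by have := dimv_cap_compl U2 W2; rewrite /dim_quot; lia.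
Qed.

Lemma dsum_rdom S S1 S2 :
  dsum_rel S S1 S2 -> dsum_vs (rdom S) (rdom S1) (rdom S2).
Proof.
move=> SE x1 x2; rewrite !mem_rdom; split=> [[y]|[[y1 ?] [y2 ?]]].
  by have [y1 [y2 ->]] := i_surj y => /SE [? ?]; split; [exists y1|exists y2].
by exists (i1 y1 + i2 y2); apply/SE.
Qed.

Lemma dsum_rran S S1 S2 :
  dsum_rel S S1 S2 -> dsum_vs (rran S) (rran S1) (rran S2).
Proof.
move=> SE x1 x2; rewrite !mem_rran; split=> [[y]|[[y1 ?] [y2 ?]]].
  by have [y1 [y2 ->]] := i_surj y => /SE [? ?]; split; [exists y1|exists y2].
by exists (i1 y1 + i2 y2); apply/SE.
Qed.

Lemma dsum_rker S S1 S2 :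
  dsum_rel S S1 S2 -> dsum_vs (rker S) (rker S1) (rker S2).
Proof.
move=> SE x1 x2; rewrite !mem_rker -SE.
by rewrite !linear0 addr0.
Qed.

Lemma dsum_rmul S S1 S2 :
  dsum_rel S S1 S2 -> dsum_vs (rmul S) (rmul S1) (rmul S2).
Proof.
move=> SE x1 x2; rewrite !mem_rmul -SE.
by rewrite !linear0 addr0.
Qed.

Lemma dsum_rshift S S1 S2 lam :
  dsum_rel S S1 S2 -> dsum_rel (Defs.rshift S lam) (Defs.rshift S1 lam)
           (Defs.rshift S2 lam).
Proof.
move=> SE x1 x2 z1 z2; rewrite !mem_rshift.
have phiB y1 y2 : i1 y1 + i2 y2 - lam *: (i1 x1 + i2 x2)
    = i1 (y1 - lam *: x1) + i2 (y2 - lam *: x2).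
  rewrite scalerDr opprD addrACA (linearB i1) (linearB i2).
  by rewrite !linearZ_LR.
split=> [[y]|[[y1 ? ->] [y2 ? ->]]]; last first.
  by exists (i1 y1 + i2 y2); [apply/SE | rewrite phiB].
have [y1 [y2 ->]] := i_surj y => /SE [? ?]; rewrite phiB => /dsum_inj [-> ->].
by split; [exists y1|exists y2].
Qed.

Lemma dsum_rpow S S1 S2 k :
  dsum_rel S S1 S2 -> dsum_rel (rpow S k) (rpow S1 k) (rpow S2 k).
Proof.
move=> SE; elim: k => [|k IH] x1 x2 z1 z2 /=.
  by rewrite !mem_rid; split=> [/dsum_inj|[-> ->]].
rewrite !mem_rcomp; split=> [[y]|[[y1 [? ?]] [y2 [? ?]]]].
  have [y1 [y2 ->]] := i_surj y => -[/IH [? ?] /SE [? ?]].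
  by split; [exists y1|exists y2].
by exists (i1 y1 + i2 y2); split; [apply/IH|apply/SE].
Qed.

(** A vector splits at a single exponent, whereas its two components may enter
    the kernels at different ones; since kernels of powers increase, the larger
    exponent serves both. *)
Lemma dsum_root_space S S1 S2 lam : dsum_rel S S1 S2 ->
  dsum_vs (root_space S lam) (root_space S1 lam) (root_space S2 lam).
Proof.
move=> SE x1 x2; rewrite !mem_root_space.
have NE k := dsum_rker (dsum_rpow k (dsum_rshift lam SE)).
split=> [[k /NE [? ?]]|[[k x1k] [l x2l]]]; first by split; exists k.
exists (maxn k l); apply/NE; split.
  exact: (subvP (sub_rker_rpow _ (leq_maxl k l))).
exact: (subvP (sub_rker_rpow _ (leq_maxr k l))).
Qed.

Lemma dsum_root_space_inf S S1 S2 : dsum_rel S S1 S2 ->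
  dsum_vs (root_space_inf S) (root_space_inf S1) (root_space_inf S2).
Proof.
move=> SE x1 x2; rewrite !mem_root_space_inf.
have NE k := dsum_rmul (dsum_rpow k SE).
split=> [[k /NE [? ?]]|[[k x1k] [l x2l]]]; first by split; exists k.
exists (maxn k l); apply/NE; split.
  exact: (subvP (sub_rmul_rpow _ (leq_maxl k l))).
exact: (subvP (sub_rmul_rpow _ (leq_maxr k l))).
Qed.

End DirectSum.

(** Entries are compared from the index 1 on because the finite sequences only
    see these; keeping zero entries is what makes the numbers additive over
    direct sums. *)
Definition Weyr_numbers (K : fieldType) (X : vectType K) (S : {vspace (X * X)})
    (W : K -> nat -> nat) (A B C : nat -> nat) : Prop :=
  forall k, (0 < k)%N ->
    [/\ forall lam, Weyr_W S lam k = W lam k,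
        Weyr_A S k = A k, Weyr_B S k = B k & Weyr_C S k = C k].

Lemma Weyr_dsum (K : fieldType) (X1 X2 X : vectType K)
    (i1 : 'Hom(X1, X)) (i2 : 'Hom(X2, X)) S S1 S2 W1 A1 B1 C1 W2 A2 B2 C2 :
    (forall x1 x2, i1 x1 + i2 x2 = 0 -> x1 = 0 /\ x2 = 0) ->
    (forall x, exists x1 x2, x = i1 x1 + i2 x2) ->
    dsum_rel i1 i2 S S1 S2 ->
    Weyr_numbers S1 W1 A1 B1 C1 -> Weyr_numbers S2 W2 A2 B2 C2 ->
  Weyr_numbers S (fun lam k => W1 lam k + W2 lam k)%N
    (fun k => A1 k + A2 k)%N (fun k => B1 k + B2 k)%N (fun k => C1 k + C2 k)%N.
Proof.
move=> inj surj SE w1 w2 k k0.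
have [wW1 <- <- <-] := w1 k k0; have [wW2 <- <- <-] := w2 k k0.
have R0 := dsum_root_space inj surj 0 SE.
have Rc : dsum_vs i1 i2 (sing_chain_space S) (sing_chain_space S1)
    (sing_chain_space S2) := dsum_cap R0 (dsum_root_space_inf inj surj SE).
have pow l := dsum_rpow inj surj l SE.
split=> [lam|||].
- rewrite -wW1 -wW2.
  have T l := dsum_rpow inj surj l (dsum_rshift inj surj lam SE).
  by apply: (dsum_dim_quot inj surj); apply: dsum_add => //; exact: dsum_rker.
- by apply: (dsum_dim_quot inj surj); apply: dsum_add => //; exact: dsum_rmul.
- by apply: (dsum_dim_quot inj surj); apply: dsum_cap => //; exact: dsum_rker.
rewrite /Weyr_C; case: eqP => _; apply: (dsum_dim_quot inj surj);
  apply: dsum_add => //; first [exact: dsum_rran | exact: dsum_rdom].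
Qed.

(** * General facts on linear relations *)

Section RelationFacts.
Variables (K : fieldType) (X : vectType K).
Implicit Types (S : {vspace (X * X)}) (U W : {vspace X}).

Lemma dim_quot_eq0 U W : (U <= W)%VS -> dim_quot U W = 0%N.
Proof.
by move=> /capv_idPl UW; have := dimv_cap_compl U W; rewrite UW /dim_quot; lia.
Qed.

Lemma dim_quot_eq0_sub U W : dim_quot U W = 0%N -> (U <= W)%VS.
Proof.
rewrite /dim_quot => quot0; have := dimv_cap_compl U W; rewrite quot0 addn0.
by move=> dimE; apply/capv_idPl/eqP; rewrite eqEdim capvSl dimE leqnn.
Qed.

Lemma rshift0 S : Defs.rshift S 0 = S.
Proof.
apply/vspaceP => -[x z]; apply/idP/idP => [/mem_rshift [y xy ->]|xz].
  by rewrite scale0r subr0.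
by apply/mem_rshift; exists z; rewrite ?scale0r ?subr0.
Qed.

Lemma rpow1 S : rpow S 1 = S.
Proof.
apply/vspaceP => -[x z]; apply/idP/idP => [/mem_rcomp [y [/mem_rid -> //]]|xz].
by apply/mem_rcomp; exists x; split=> //; apply/mem_rid.
Qed.

Lemma rker_rpow_eq0 S k : rker S = 0%VS -> rker (rpow S k) = 0%VS.
Proof.
move=> S0; apply/eqP; rewrite -subv0; apply/subvP => x; rewrite mem_rker memv0.
elim: k => [|k IH] /=; first by move=> /mem_rid ->.
move=> /mem_rcomp [y [xy /mem_rker]]; rewrite S0 memv0 => /eqP y0.
by apply: IH; rewrite -y0.
Qed.

Lemma rmul_rpow_eq0 S k : rmul S = 0%VS -> rmul (rpow S k) = 0%VS.
Proof.
move=> S0; apply/eqP; rewrite -subv0; apply/subvP => z; rewrite mem_rmul memv0.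
elim: k z => [|k IH] z /=; first by move=> /mem_rid <-.
move=> /mem_rcomp [y [/IH /eqP -> /mem_rmul]].
by rewrite S0 memv0.
Qed.

Lemma rker_rshift_eq0 S lam :
  (forall x, (x, lam *: x) \in S -> x = 0) -> rker (Defs.rshift S lam) = 0%VS.
Proof.
move=> S0; apply/eqP; rewrite -subv0; apply/subvP => x.
rewrite mem_rker memv0 => /mem_rshift [y xy /eqP].
by rewrite eq_sym subr_eq0 => /eqP yE; apply/eqP/S0; rewrite -yE.
Qed.

Lemma root_space_eq0 S lam :
  rker (Defs.rshift S lam) = 0%VS -> root_space S lam = 0%VS.
Proof.
move=> S0; apply/eqP; rewrite -subv0; apply/subvP => x.
by move=> /mem_root_space [k]; rewrite rker_rpow_eq0.
Qed.

Lemma root_space_inf_eq0 S : rmul S = 0%VS -> root_space_inf S = 0%VS.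
Proof.
move=> S0; apply/eqP; rewrite -subv0; apply/subvP => x.
by move=> /mem_root_space_inf [k]; rewrite rmul_rpow_eq0.
Qed.

Lemma Weyr_numbers_ext S (W W' : K -> nat -> nat) A B C A' B' C' :
    Weyr_numbers S W A B C ->
    (forall k, (0 < k)%N -> [/\ forall lam, W lam k = W' lam k,
       A k = A' k, B k = B' k & C k = C' k]) ->
  Weyr_numbers S W' A' B' C'.
Proof.
move=> w e k k0; have [wW -> -> ->] := w k k0; have [eW -> -> ->] := e k k0.
by split=> // lam; rewrite wW.
Qed.

(** Without finite eigenvalues the root space at 0 is null, and with it the
    singular chain space, so the sums with them in A and C disappear. *)
Lemma Weyr_numbers_no_eigenvalue S :
    (forall lam x, (x, lam *: x) \in S -> x = 0) ->
  Weyr_numbers S (fun _ _ => 0%N)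
    (fun k => \dim (rmul (rpow S k)) - \dim (rmul (rpow S k.-1)))%N
    (fun _ => 0%N)
    (fun k => if k == 1%N then dim_quot (rran S + rdom S)%VS (rran S)
              else \dim (rran (rpow S k)) - \dim (rran (rpow S k.+1)))%N.
Proof.
move=> S0 k k0; have ker0 lam := rker_rshift_eq0 (S0 lam).
have Rc0 : sing_chain_space S = 0%VS.
  by rewrite /sing_chain_space (root_space_eq0 (ker0 0)) cap0v.
split=> [lam|||].
- by rewrite /Weyr_W !(rker_rpow_eq0 _ (ker0 lam)) dim_quot_eq0.
- by rewrite /Weyr_A Rc0 !addv0 dim_quotE // sub_rmul_rpow // leq_pred.
- by rewrite /Weyr_B Rc0 !capv0 dim_quot_eq0.
rewrite /Weyr_C (root_space_eq0 (ker0 0)) !addv0; case: eqP => // _.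
by rewrite dim_quotE // sub_rran_rpow.
Qed.

Lemma Weyr_C_eq0 S k : (0 < k)%N ->
  (forall l, (0 < l)%N -> (rran (rpow S l) + root_space S 0 = fullv)%VS) ->
  Weyr_C S k = 0%N.
Proof.
move=> k0 Sfull; rewrite /Weyr_C; case: eqP => [_|_].
  by have := Sfull 1%N isT; rewrite rpow1 => ->; rewrite dim_quot_eq0 ?subvf.
by rewrite (Sfull k.+1) // dim_quot_eq0 ?subvf.
Qed.

(** The spaces [N((S - lam)^k) + R_c(S)] increase from [R_c(S)]; if every step
    is trivial they all stay equal to it, so the root space at [lam] lies in
    [R_c(S)]. *)
Lemma proper_eigenvalueP S lam :
  proper_eigenvalue S lam <-> exists2 k, (0 < k)%N & Weyr_W S lam k <> 0%N.
Proof.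
split=> [[_ /negP nsub]|[k k0 Wk]].
  apply: contrapT => W0; apply: nsub; apply/subvP => x /mem_root_space [k].
  move: x; apply/subvP; elim: k => [|k IH].
    apply/subvP => x /mem_rker /mem_rid ->; exact: mem0v.
  have : Weyr_W S lam k.+1 = 0%N.
    by apply: contrapT => Wk; apply: W0; exists k.+1.
  move=> /dim_quot_eq0_sub /=.
  rewrite subv_add => /andP [NS _]; apply: (subv_trans NS).
  by rewrite subv_add IH subvv.
split.
  move=> S0; apply: Wk; rewrite /Weyr_W !(rker_rpow_eq0 _ S0); exact: dim_quot_eq0.
apply/negP => sub; apply: Wk; apply: dim_quot_eq0; rewrite subv_add addvSr andbT.
apply: subv_trans (addvSr _ _); apply: subv_trans sub; apply/subvP => x xk.
by apply/mem_root_space; exists k.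
Qed.

End RelationFacts.

(** * Kernel relations of block diagonal pencils *)

Section KernelRelations.
Variable K : fieldType.

Lemma rshift_kernel_relation n m (E F : 'M[K]_(n, m)) lam :
  Defs.rshift (kernel_relation E F) lam = kernel_relation E (F - lam *: E).
Proof.
apply/vspaceP => -[x z]; apply/idP/idP.
  move=> /mem_rshift [y /mem_kernel_relation xy ->]; apply/mem_kernel_relation.
  by rewrite mulmxBl mulmxBr xy -scalemxAl -scalemxAr.
move=> /mem_kernel_relation; rewrite mulmxBl => /eqP; rewrite subr_eq => /eqP xz.
apply/mem_rshift; exists (z + lam *: x); last by rewrite addrK.
by apply/mem_kernel_relation; rewrite xz mulmxDr -scalemxAl -scalemxAr.
Qed.

Lemma rpow_kernel_relation1M m (M : 'M[K]_m) k :
  rpow (kernel_relation 1%:M M) k = kernel_relation 1%:M (M ^+ k).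
Proof.
apply/vspaceP => -[x z]; elim: k z => [|k IH] z /=; apply/idP/idP.
- by move=> /mem_rid ->; apply/mem_kernel_relation.
- by move=> /mem_kernel_relation; rewrite !mul1mx => ->; apply/mem_rid.
- move=> /mem_rcomp [y []]; rewrite IH.
  move=> /mem_kernel_relation xy /mem_kernel_relation yz.
  by apply/mem_kernel_relation; rewrite exprS -mulmxA xy mul1mx.
move=> /mem_kernel_relation xz; apply/mem_rcomp; exists (M ^+ k *m x).
rewrite IH !mem_kernel_relation !mul1mx -[z]mul1mx -xz exprS.
by split; last exact: mulmxA.
Qed.

Lemma rpow_kernel_relationM1 m (M : 'M[K]_m) k :
  rpow (kernel_relation M 1%:M) k = kernel_relation (M ^+ k) 1%:M.
Proof.
apply/vspaceP => -[x z]; elim: k z => [|k IH] z /=; apply/idP/idP.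
- by move=> /mem_rid ->; apply/mem_kernel_relation.
- by move=> /mem_kernel_relation; rewrite !mul1mx => ->; apply/mem_rid.
- move=> /mem_rcomp [y []]; rewrite IH.
  move=> /mem_kernel_relation xy /mem_kernel_relation yz.
  by apply/mem_kernel_relation; rewrite exprSr -mulmxA -yz xy mul1mx.
move=> /mem_kernel_relation xz; apply/mem_rcomp; exists (M *m z).
rewrite IH !mem_kernel_relation -[x]mul1mx xz !mul1mx exprSr.
by split; first exact/esym/mulmxA.
Qed.

Lemma rker_kernel_relation n m (E F : 'M[K]_(n, m)) x :
  x \in rker (kernel_relation E F) <-> F *m x = 0.
Proof. by rewrite mem_rker mem_kernel_relation mulmx0. Qed.

Lemma rmul_kernel_relation n m (E F : 'M[K]_(n, m)) y :
  y \in rmul (kernel_relation E F) <-> E *m y = 0.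
Proof. by rewrite mem_rmul mem_kernel_relation mulmx0; split. Qed.

(** An invertible matrix splits its source into two groups of columns, whose
    spans are complementary. *)
Lemma dsum_col_mx m1 m2 (P : 'M[K]_(m1 + m2)) : P \in unitmx ->
  exists (i1 : 'Hom('cV[K]_m1, 'cV[K]_(m1 + m2)))
         (i2 : 'Hom('cV[K]_m2, 'cV[K]_(m1 + m2))),
    [/\ forall x1 x2, i1 x1 + i2 x2 = 0 -> x1 = 0 /\ x2 = 0,
        forall x, exists x1 x2, x = i1 x1 + i2 x2 &
        forall x1 x2, i1 x1 + i2 x2 = P *m col_mx x1 x2].
Proof.
move=> P_unit; exists (linfun (mulmx (lsubmx P))), (linfun (mulmx (rsubmx P))).
have phiE x1 x2 : linfun (mulmx (lsubmx P)) x1 + linfun (mulmx (rsubmx P)) x2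
    = P *m col_mx x1 x2 by rewrite !lfunE /= -mul_row_col hsubmxK.
split; last exact: phiE.
  move=> x1 x2; rewrite phiE => /(congr1 (mulmx (invmx P))).
  by rewrite mulKmx // mulmx0 -col_mx0 => /eq_col_mx.
move=> x; exists (usubmx (invmx P *m x)), (dsubmx (invmx P *m x)).
by rewrite phiE vsubmxK mulKVmx.
Qed.

(** The column transformation [P] provides the isomorphism with the direct sum;
    the row transformation [Q] merely rewrites the equations [F x = E y] as an
    equivalent system. *)
Lemma Weyr_diag2 n1 m1 n2 m2 (E F : 'M[K]_(n1 + n2, m1 + m2))
    (Q : 'M_(n1 + n2)) (P : 'M_(m1 + m2)) (E1 F1 : 'M_(n1, m1))
    (E2 F2 : 'M_(n2, m2)) W1 A1 B1 C1 W2 A2 B2 C2 :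
    Q \in unitmx -> P \in unitmx ->
    Q *m E *m P = diag2_mx E1 E2 -> Q *m F *m P = diag2_mx F1 F2 ->
    Weyr_numbers (kernel_relation E1 F1) W1 A1 B1 C1 ->
    Weyr_numbers (kernel_relation E2 F2) W2 A2 B2 C2 ->
  Weyr_numbers (kernel_relation E F) (fun lam k => W1 lam k + W2 lam k)%N
    (fun k => A1 k + A2 k)%N (fun k => B1 k + B2 k)%N (fun k => C1 k + C2 k)%N.
Proof.
move=> Qu Pu QEP QFP; have [i1 [i2 [inj surj phiE]]] := dsum_col_mx Pu.
apply: Weyr_dsum inj surj _ => x1 x2 y1 y2; rewrite !phiE.
have diagE : forall (M : 'M_(n1 + n2, m1 + m2)) M1 M2
      (z1 : 'cV_m1) (z2 : 'cV_m2),
    Q *m M *m P = diag2_mx M1 M2 ->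
    Q *m (M *m (P *m col_mx z1 z2)) = col_mx (M1 *m z1) (M2 *m z2).
  move=> M M1 M2 z1 z2 QMP; rewrite !mulmxA QMP /diag2_mx mul_block_col.
  by rewrite !mul0mx addr0 add0r.
rewrite !mem_kernel_relation; split=> [/(congr1 (mulmx Q))|[e1 e2]].
  by rewrite (diagE _ _ _ _ _ QFP) (diagE _ _ _ _ _ QEP) => /eq_col_mx.
rewrite -[LHS](mulKmx Qu) -[RHS](mulKmx Qu).
by rewrite (diagE _ _ _ _ _ QFP) (diagE _ _ _ _ _ QEP) e1 e2.
Qed.

Lemma Weyr_diag_blocks (T : Type) (f g : T -> nat)
    (E F : forall t, 'M[K]_(f t, g t)) (A B C : T -> nat -> nat) (s : seq T) :
    (forall t, Weyr_numbers (kernel_relation (E t) (F t))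
       (fun _ _ => 0%N) (A t) (B t) (C t)) ->
  Weyr_numbers (kernel_relation (diag_blocks E s) (diag_blocks F s))
    (fun _ _ => 0%N) (fun k => sumn [seq A t k | t <- s])
    (fun k => sumn [seq B t k | t <- s]) (fun k => sumn [seq C t k | t <- s]).
Proof.
move=> wEF; elim: s => [|t s IH] /=.
  move=> k k0; have U0 (U W : {vspace 'cV[K]_0}) : dim_quot U W = 0%N.
    apply/dim_quot_eq0/subvP => x _.
    by rewrite (_ : x = 0) ?mem0v //; apply/matrixP => -[].
  by split=> [lam|||]; rewrite ?/Weyr_W ?/Weyr_A ?/Weyr_B ?/Weyr_C ?U0 // if_same.
apply: (Weyr_diag2 (Q := 1%:M) (P := 1%:M) _ _ _ _ (wEF t) IH);
  by rewrite ?unitmx1 // mul1mx mulmx1.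
Qed.

Lemma scalar_mx_diag_blocks (T : Type) (f : T -> nat) (s : seq T) :
  1%:M = diag_blocks (fun t => 1%:M : 'M[K]_(f t)) s.
Proof.
elim: s => [|t s IH] /=; first by apply/matrixP => -[].
by rewrite /diag2_mx -IH -scalar_mx_block.
Qed.

Lemma tr_diag_blocks (T : Type) (f g : T -> nat)
    (E : forall t, 'M[K]_(f t, g t)) (s : seq T) :
  (diag_blocks E s)^T = diag_blocks (fun t => (E t)^T) s.
Proof.
elim: s => [|t s IH] /=; first exact: trmx0.
by rewrite /diag2_mx tr_block_mx IH !trmx0.
Qed.

(** The powers of the shifted graph of a matrix [J] are the graphs of the powers
    of [J - lam], so the kernels on the two sides coincide. *)
Lemma Weyr_jordan m (J : 'M[K]_m) :
  Weyr_numbers (kernel_relation 1%:M J)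
    (fun lam k => \dim (mx_ker ((J - lam%:M) ^+ k)) -
                  \dim (mx_ker ((J - lam%:M) ^+ k.-1)))%N
    (fun _ => 0%N) (fun _ => 0%N) (fun _ => 0%N).
Proof.
set S := kernel_relation _ _.
have kerE lam k :
    rker (rpow (Defs.rshift S lam) k) = mx_ker ((J - lam%:M) ^+ k).
  rewrite rshift_kernel_relation scalemx1 rpow_kernel_relation1M.
  apply/vspaceP => x; apply/idP/idP.
    by move=> /rker_kernel_relation ?; apply/mem_mx_ker.
  by move=> /mem_mx_ker ?; apply/rker_kernel_relation.
have mul0 : rmul S = 0%VS.
  apply/eqP; rewrite -subv0; apply/subvP => y /rmul_kernel_relation.
  by rewrite mul1mx => ->; apply: mem0v.
have Rc0 : sing_chain_space S = 0%VS.
  by rewrite /sing_chain_space (root_space_inf_eq0 mul0) capv0.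
move=> k k0; split=> [lam|||].
- rewrite /Weyr_W Rc0 !addv0 dim_quotE ?kerE //.
  by rewrite -!kerE sub_rker_rpow // leq_pred.
- by rewrite /Weyr_A Rc0 !(rmul_rpow_eq0 _ mul0) dim_quot_eq0.
- by rewrite /Weyr_B Rc0 !capv0 dim_quot_eq0.
apply: Weyr_C_eq0 => // l l0.
(* Fitting: beyond the exponent where its kernels stabilize, and here also
   beyond [l], a power of [J] meets its kernel trivially in its image, so by
   counting dimensions kernel and image span everything *)
have [|n0 stab] := @chain_stable _ _ (fun k => rker (rpow (Defs.rshift S 0) k)).
  by left=> ? ?; apply: sub_rker_rpow.
pose n := (n0 + l)%N; pose f := linfun (mulmx (J ^+ n) : 'cV_m -> 'cV_m).
have kerf : lker f = rker (rpow (Defs.rshift S 0) n).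
  rewrite kerE raddf0 subr0; apply/vspaceP => x; rewrite memv_ker lfunE /=.
  by apply/eqP/idP => /mem_mx_ker.
have dis : (lker f :&: limg f)%VS = 0%VS.
  apply/eqP; rewrite -subv0; apply/subvP => y; rewrite memv_cap => /andP [yk].
  move=> /memv_imgP [x _ yE]; move: yk; rewrite yE !memv_ker !lfunE /= memv0.
  rewrite mulmxA => /eqP JJx.
  have : x \in lker f.
    rewrite kerf stab ?leq_addr // -(stab (n + n)%N); last by rewrite /n; lia.
    by rewrite kerE raddf0 subr0; apply/mem_mx_ker; rewrite exprD.
  by rewrite memv_ker lfunE.
apply/eqP; rewrite eqEsubv subvf /=.
have <- : (lker f + limg f)%VS = fullv.
  apply/eqP; rewrite eqEdim subvf dimv_disjoint_sum //=.
  by rewrite -(limg_ker_dim f fullv) capfv.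
rewrite subv_add; apply/andP; split.
  apply: subv_trans (addvSr _ _); rewrite kerf; apply/subvP => x xk.
  by apply/mem_root_space; exists n.
apply: subv_trans (addvSl _ _).
apply: subv_trans (sub_rran_rpow S (leq_addl n0 l)).
apply/subvP => _ /memv_imgP [x _ ->]; apply/mem_rran; exists x.
rewrite rpow_kernel_relation1M; apply/mem_kernel_relation.
by rewrite lfunE /= mul1mx.
Qed.

End KernelRelations.

(** * Coordinates of column vectors *)

Section Coordinates.
Variable K : fieldType.

(** The coordinate indexed by a natural number, 0 outside the range: shifting a
    vector then needs no case distinction at the ends. *)
Definition coord0 d (x : 'cV[K]_d) (i : nat) : K :=
  oapp (fun j => x j ord0) 0 (insub i).

Lemma coord0E d (x : 'cV[K]_d) (j : 'I_d) : coord0 x j = x j ord0.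
Proof. by rewrite /coord0 valK. Qed.

Lemma coord0_out d (x : 'cV[K]_d) i : (d <= i)%N -> coord0 x i = 0.
Proof. by move=> di; rewrite /coord0 insubN // -leqNgt. Qed.

Lemma coord0P d (x y : 'cV[K]_d) :
  (forall i, (i < d)%N -> coord0 x i = coord0 y i) -> x = y.
Proof.
by move=> xy; apply/matrixP => i j; rewrite ord1 -!coord0E xy.
Qed.

Lemma coord0_col d (f : nat -> K) i :
  coord0 (\col_(j < d) f j) i = if (i < d)%N then f i else 0.
Proof.
by rewrite /coord0; case: insubP => [j -> /= <-|/negbTE ->] //=; rewrite mxE.
Qed.

Lemma coord0_0 d i : coord0 (0 : 'cV[K]_d) i = 0.
Proof. by rewrite /coord0; case: insubP => //= j _ _; rewrite mxE. Qed.

Lemma coord0Z d a (x : 'cV[K]_d) i : coord0 (a *: x) i = a * coord0 x i.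
Proof.
by rewrite /coord0; case: insubP => [j _ _|_] /=; rewrite ?mxE ?mulr0.
Qed.

Lemma coord0D d (x y : 'cV[K]_d) i : coord0 (x + y) i = coord0 x i + coord0 y i.
Proof.
by rewrite /coord0; case: insubP => [j _ _|_] /=; rewrite ?mxE ?addr0.
Qed.

Lemma coord0_col_mx d1 d2 (x1 : 'cV[K]_d1) (x2 : 'cV[K]_d2) i :
  coord0 (col_mx x1 x2) i =
  if (i < d1)%N then coord0 x1 i else coord0 x2 (i - d1).
Proof.
case: (ltnP i (d1 + d2)) => [id|di]; last first.
  by rewrite !coord0_out //; case: ltnP => //; lia.
suff col_mxE (o : 'I_(d1 + d2)) : coord0 (col_mx x1 x2) o =
    if (o < d1)%N then coord0 x1 o else coord0 x2 (o - d1).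
  exact: (col_mxE (Ordinal id)).
rewrite coord0E -(splitK o); case: (split o) => j /=.
  by rewrite col_mxEu ltn_ord coord0E.
by rewrite col_mxEd ltnNge leq_addr /= addKn coord0E.
Qed.

(** The matrices of the Kronecker blocks have at most one 1 in each row; row [j]
    picks the coordinate [f j], and a value [f j] beyond the last column stands
    for a zero row. *)
Lemma coord0_select n d (f : 'I_n -> nat) (M : 'M[K]_(n, d)) (x : 'cV[K]_d) i :
  (forall i j, M i j = (nat_of_ord j == f i)%:R) ->
  coord0 (M *m x) i = oapp (fun j => coord0 x (f j)) 0 (insub i).
Proof.
move=> ME; rewrite {1}/coord0; case: insubP => //= j _ _.
rewrite mxE; case: (ltnP (f j) d) => [fd|df].
  rewrite (bigD1 (Ordinal fd)) //= ME eqxx mul1r big1 => [|l lf].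
    by rewrite addr0 (coord0E x (Ordinal fd) : coord0 x (f j) = _).
  by rewrite ME (negbTE (_ : val l != f j)) ?mul0r.
rewrite coord0_out // big1 // => l _; rewrite ME.
by rewrite (ltn_eqF (leq_trans (ltn_ord l) df)) mul0r.
Qed.

Lemma coord0_nilp d (x : 'cV[K]_d) i :
  coord0 (nilp_block K d *m x) i =
  if (i < d)%N && (0 < i)%N then coord0 x i.-1 else 0.
Proof.
pose f (j : 'I_d) := if nat_of_ord j is i.+1 then i else d.
rewrite (@coord0_select _ _ f) => [|j l].
  case: insubP => [j -> /= <-|/negbTE ->] //.
  by rewrite /f; case: (nat_of_ord j) => [|?] //=; rewrite coord0_out.
rewrite mxE /f; case: (nat_of_ord j) => [|j'] /=; last by rewrite eqSS eq_sym.
by rewrite (ltn_eqF (ltn_ord l)).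
Qed.

Lemma coord0_K d (x : 'cV[K]_d) i :
  coord0 (K_block K d *m x) i = if (i.+1 < d)%N then coord0 x i else 0.
Proof.
rewrite (@coord0_select _ _ val) => [|j l]; last by rewrite mxE.
by case: insubP => [j /= ? ji|?] /=; rewrite ?ji; case: ltnP => //; lia.
Qed.

Lemma coord0_L d (x : 'cV[K]_d) i :
  coord0 (L_block K d *m x) i = if (i.+1 < d)%N then coord0 x i.+1 else 0.
Proof.
rewrite (@coord0_select _ _ (fun j => (val j).+1)) => [|j l];
  last by rewrite mxE.
by case: insubP => [j /= ? ji|?] /=; rewrite ?ji; case: ltnP => //; lia.
Qed.

Lemma coord0_trK g (x : 'cV[K]_g.-1) i :
  coord0 ((K_block K g)^T *m x) i = coord0 x i.
Proof.
rewrite (@coord0_select _ _ val) => [|j l]; last by rewrite !mxE eq_sym.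
by case: insubP => [j /= ? <-|?] //=; rewrite coord0_out //; lia.
Qed.

Lemma coord0_trL g (x : 'cV[K]_g.-1) i :
  coord0 ((L_block K g)^T *m x) i = if (0 < i)%N then coord0 x i.-1 else 0.
Proof.
pose f (j : 'I_g) := if nat_of_ord j is i.+1 then i else g.
rewrite (@coord0_select _ _ f) => [|j l].
  case: insubP => [j _ /= <-|ig] /=.
    rewrite /f; case: (nat_of_ord j) => [|?] //=.
    by rewrite coord0_out // leq_pred.
  by case: ltnP => // i0; rewrite coord0_out //; lia.
rewrite !mxE /f; case: (nat_of_ord j) => [|j'] /=; last by rewrite eqSS eq_sym.
by rewrite (ltn_eqF (leq_trans (ltn_ord l) (leq_pred g))).
Qed.

Lemma dim_coord0_initial d (U : {vspace 'cV[K]_d}) k : (k <= d)%N ->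
  (forall x, x \in U <-> (forall i, (k <= i)%N -> coord0 x i = 0)) ->
  \dim U = k.
Proof.
move=> /subnKC; move: (d - k)%N => l dE; case: _ / dE U => U UE.
have [i1 [i2 [inj surj phiE]]] := @dsum_col_mx K k l 1%:M (unitmx1 _ _).
rewrite (@dsum_dim _ _ _ _ i1 i2 inj surj U fullv 0).
  by rewrite dimv0 dimvf dim_matrix addn0 [LHS]muln1.
move=> x1 x2; rewrite phiE mul1mx UE memvf memv0; split=> [x0|[_ /eqP ->] i ki].
  split=> //; apply/eqP/coord0P => i _; rewrite coord0_0.
  have := x0 (k + i)%N (leq_addr _ _).
  by rewrite coord0_col_mx ltnNge leq_addr addKn.
by rewrite coord0_col_mx ltnNge ki coord0_0.
Qed.

Lemma dim_coord0_final d (U : {vspace 'cV[K]_d}) k :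
  (forall x, x \in U <-> (forall i, (i < k)%N -> coord0 x i = 0)) ->
  \dim U = (d - k)%N.
Proof.
case: (leqP k d) => [/subnKC|dk UE]; last first.
  rewrite (_ : U = 0%VS) ?dimv0; first by apply/esym/eqP; rewrite subn_eq0 ltnW.
  apply/eqP; rewrite -subv0; apply/subvP => x /UE x0; rewrite memv0.
  by apply/eqP/coord0P => i id; rewrite coord0_0 x0 // (ltn_trans id).
move: (d - k)%N => l dE; case: _ / dE U => U UE.
have [i1 [i2 [inj surj phiE]]] := @dsum_col_mx K k l 1%:M (unitmx1 _ _).
rewrite (@dsum_dim _ _ _ _ i1 i2 inj surj U 0 fullv).
  by rewrite dimv0 dimvf dim_matrix add0n [LHS]muln1.
move=> x1 x2; rewrite phiE mul1mx UE memvf memv0; split=> [x0|[/eqP -> _] i ki].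
  split=> //; apply/eqP/coord0P => i ik; rewrite coord0_0.
  by have := x0 i ik; rewrite coord0_col_mx ik.
by rewrite coord0_col_mx ki coord0_0.
Qed.

End Coordinates.

(** * The singular and infinite Kronecker blocks *)

Section KroneckerBlocks.
Variable K : fieldType.

Lemma coord0_nilpX d k (x : 'cV[K]_d) i :
  coord0 (nilp_block K d ^+ k *m x) i =
  if (i < d)%N && (k <= i)%N then coord0 x (i - k) else 0.
Proof.
elim: k i => [|k IH] i.
  by rewrite mul1mx leq0n andbT subn0; case: ltnP => // ?; rewrite coord0_out.
rewrite exprS -[_ * _]/(_ *m _) -mulmxA coord0_nilp IH.
case: i => [|i]; first by rewrite /= andbF.
by rewrite /= ltnS subSS andbT; case: ltnP => //= id; rewrite (ltnW id).
Qed.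

Lemma Weyr_nilp_block d :
  Weyr_numbers (kernel_relation (nilp_block K d) 1%:M) (fun _ _ => 0%N)
    (fun k => (k <= d)%N : nat) (fun _ => 0%N) (fun _ => 0%N).
Proof.
set S := kernel_relation _ _.
have ranS k : (rran (rpow S k) = fullv)%VS.
  apply/eqP; rewrite eqEsubv subvf; apply/subvP => z _; apply/mem_rran.
  exists (nilp_block K d ^+ k *m z); rewrite rpow_kernel_relationM1.
  by apply/mem_kernel_relation; rewrite mul1mx.
have mulS k : \dim (rmul (rpow S k)) = minn k d.
  rewrite (@dim_coord0_final _ _ _ (d - k)); first by lia.
  move=> z; rewrite rpow_kernel_relationM1; split.
    move=> /rmul_kernel_relation Nz i idk.
    have := congr1 (fun y => coord0 y (i + k)) Nz.
    rewrite /= coord0_nilpX coord0_0 addnK leq_addl andbT.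
    by rewrite (_ : (_ < d)%N = true) //; lia.
  move=> z0; apply/rmul_kernel_relation/coord0P => i id.
  rewrite coord0_nilpX coord0_0.
  by case: ifP => // /andP [? ?]; rewrite z0 //; lia.
apply: (Weyr_numbers_ext (Weyr_numbers_no_eigenvalue (S := S) _)).
  move=> lam x /mem_kernel_relation; rewrite mul1mx => xE.
  apply: coord0P; elim=> [|i IH] id;
    rewrite xE coord0_nilp coord0_0 ?andbF //.
  rewrite id /= coord0Z IH ?coord0_0 ?mulr0 //.
  exact: ltnW.
move=> k k0; split=> //; first by rewrite !mulS; lia.
have := ranS 1%N; rewrite rpow1 => ->.
by rewrite !ranS subnn dim_quot_eq0 ?subvf ?if_same.
Qed.

(** The relation consists of the pairs with [y_i = x_(i+1)] wherever both sides make
    sense; the last coordinate of [y] is free.  Iterating shifts by [k]. *)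
Lemma mem_rpow_KL d (x z : 'cV[K]_d) k :
  (x, z) \in rpow (kernel_relation (K_block K d) (L_block K d)) k <->
  (forall i, (i + k < d)%N -> coord0 x (i + k) = coord0 z i).
Proof.
have SE (u v : 'cV[K]_d) :
    (u, v) \in kernel_relation (K_block K d) (L_block K d)
    <-> (forall i, (i.+1 < d)%N -> coord0 u i.+1 = coord0 v i).
  rewrite mem_kernel_relation; split=> [uv i id|uv].
    by have := congr1 (fun y => coord0 y i) uv; rewrite /= coord0_L coord0_K id.
  by apply: coord0P => i id; rewrite coord0_L coord0_K; case: ifP => // /uv.
elim: k z => [|k IH] z.
  rewrite mem_rid; split=> [-> i _|xz]; first by rewrite addn0.
  by apply: coord0P => i id; rewrite -xz ?addn0.
rewrite /= mem_rcomp; split=> [[y [/IH xy /SE yz]] i idk|xz].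
  by rewrite addnS -addSn xy ?yz //; lia.
(* [z] determines the intermediate vector but for its 0-th coordinate, which
   comes from [x] *)
exists (\col_(i < d) (if val i is j.+1 then coord0 z j else coord0 x k)).
pose f i := if i is j.+1 then coord0 z j else coord0 x k.
split; [apply/IH | apply/SE] => i id;
  rewrite (coord0_col _ f); (case: ifP => [_|]; last by lia).
  by case: i id => [|i] id //=; rewrite addSnnS xz //; lia.
by [].
Qed.

Lemma Weyr_KL_block d :
  Weyr_numbers (kernel_relation (K_block K d) (L_block K d)) (fun _ _ => 0%N)
    (fun _ => 0%N) (fun k => (k <= d)%N : nat) (fun _ => 0%N).
Proof.
set S := kernel_relation _ _.
have R0full : root_space S 0 = fullv.
  apply/eqP; rewrite eqEsubv subvf; apply/subvP => x _; apply/mem_root_space.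
  exists d; rewrite rshift0; apply/mem_rker/mem_rpow_KL => i; lia.
have Rcfull : sing_chain_space S = fullv.
  rewrite /sing_chain_space R0full capfv.
  apply/eqP; rewrite eqEsubv subvf.
  apply/subvP => x _; apply/mem_root_space_inf.
  by exists d; apply/mem_rmul/mem_rpow_KL => i; lia.
have addvf (U : {vspace 'cV[K]_d}) : (U + fullv)%VS = fullv.
  by apply/eqP; rewrite eqEsubv subvf addvSr.
have kerS k : \dim (rker (rpow S k)) = minn k d.
  apply: dim_coord0_initial => [|x]; first by lia.
  rewrite mem_rker mem_rpow_KL; split=> x0 i ki.
    case: (ltnP i d) => id; last by rewrite coord0_out.
    have kd : (k <= i)%N by lia.
    by have := x0 (i - k)%N; rewrite subnK // coord0_0 => ->.
  by rewrite coord0_0 x0 //; lia.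
move=> k k0; split=> [lam|||].
- by rewrite /Weyr_W Rcfull !addvf dim_quot_eq0.
- by rewrite /Weyr_A Rcfull !addvf dim_quot_eq0.
- rewrite /Weyr_B Rcfull !capvf dim_quotE ?sub_rker_rpow ?leq_pred // !kerS.
  by case: leqP => /= ?; lia.
by apply: Weyr_C_eq0 => // l _; rewrite R0full addvf.
Qed.

(** Here the shift goes the other way, and [x] may be followed for [k] steps
    only if its last [k] coordinates vanish, as they would leave the chain. *)
Lemma mem_rpow_trKL g (x z : 'cV[K]_g.-1) k :
  (x, z) \in rpow (kernel_relation (K_block K g)^T (L_block K g)^T) k <->
  (forall i, (i < g.-1)%N ->
     coord0 z i = if (k <= i)%N then coord0 x (i - k) else 0)
  /\ (forall i, (g.-1 <= i + k)%N -> coord0 x i = 0).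
Proof.
have SE (u v : 'cV[K]_g.-1) :
    (u, v) \in kernel_relation (K_block K g)^T (L_block K g)^T
    <-> (forall i, coord0 v i = if (0 < i)%N then coord0 u i.-1 else 0).
  rewrite mem_kernel_relation; split=> [uv i|uv].
    have := congr1 (fun y => coord0 y i) uv.
    by rewrite /= coord0_trL coord0_trK => ->.
  by apply: coord0P => i id; rewrite coord0_trL coord0_trK uv.
elim: k z => [|k IH] z.
  rewrite mem_rid; split=> [->|[xz _]]; last first.
    by apply: coord0P => i id; rewrite xz ?subn0.
  by split=> i; rewrite ?subn0 // addn0; apply: coord0_out.
rewrite /= mem_rcomp; split=> [[y [/IH [yx x0] /SE zy]]|[zx x0]].
  split=> [[|i] id|i gik]; rewrite ?zy //=.
    by rewrite ltnS subSS yx //; lia.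
  case: (leqP g.-1 (i + k)) => [/x0 //|igk].
  have := zy (i + k).+1; rewrite coord0_out /=; last by lia.
  by rewrite yx // leq_addl addnK => ->.
pose f i := if (k <= i)%N then coord0 x (i - k) else 0.
exists (\col_(i < g.-1) f i); split.
  apply/IH; split=> [i id|i igk]; last by rewrite x0 //; lia.
  by rewrite coord0_col id.
apply/SE => i; case: (ltnP i g.-1) => [id|gi].
  rewrite zx //; case: i id => [|i] id //=.
  by rewrite coord0_col (ltnW id) /f ltnS subSS.
rewrite coord0_out //; case: i gi => [|i] //= gi; rewrite coord0_col.
by case: ifP => // _; rewrite /f; case: ifP => // ki; rewrite x0 //; lia.
Qed.

Lemma Weyr_trKL_block g :
  Weyr_numbers (kernel_relation (K_block K g)^T (L_block K g)^T)
    (fun _ _ => 0%N) (fun _ => 0%N) (fun _ => 0%N)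
    (fun k => (k.+2 <= g)%N : nat).
Proof.
set S := kernel_relation _ _.
have Sk := @mem_rpow_trKL g; rewrite -/S in Sk.
have mulS k : rmul (rpow S k) = 0%VS.
  apply/eqP; rewrite -subv0; apply/subvP => z /mem_rmul /Sk [zE _].
  rewrite memv0; apply/eqP/coord0P => i id.
  by rewrite zE // !coord0_0 if_same.
have ranP k z :
    z \in rran (rpow S k) <-> (forall i, (i < k)%N -> coord0 z i = 0).
  rewrite mem_rran; split=> [[x /Sk [zE _]] i ik|z0].
    case: (ltnP i g.-1) => id; last by rewrite coord0_out.
    by rewrite zE // leqNgt ik.
  pose f i := coord0 z (i + k).
  exists (\col_(i < g.-1) f i); apply/Sk; split=> i ig.
    case: leqP => [ki|/z0 //]; rewrite coord0_col (_ : (_ < _)%N); last by lia.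
    by rewrite /f subnK.
  by rewrite coord0_col /f (coord0_out _ ig) if_same.
have ranS k : \dim (rran (rpow S k)) = (g.-1 - k)%N.
  exact/dim_coord0_final/ranP.
apply: (Weyr_numbers_ext (Weyr_numbers_no_eigenvalue (S := S) _)).
  move=> lam x; rewrite -[S]rpow1 => /Sk [xE x0]; apply: coord0P => i _.
  (* the last coordinate vanishes, and each other one is [lam] times the next *)
  rewrite coord0_0.
  have x0' : forall j l, (g.-1 <= l + j.+1)%N -> coord0 x l = 0.
    elim=> [|j IH] l lg; first exact: x0.
    case: (ltnP l.+1 g.-1) => ld; last by rewrite x0 // addn1.
    by have := xE l.+1 ld; rewrite coord0Z IH ?mulr0 /= ?subn1 // addSnnS.
  by apply: (x0' g); lia.
move=> k k0; split=> //; first by rewrite !mulS subnn.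
case: eqP => [->|k1]; last by rewrite !ranS; case: leqP => /= ?; lia.
case: leqP => [g2|g3].
  apply/dim_quot_eq0; rewrite subv_add subvv; apply/subvP => x /mem_rdom [y].
  rewrite -(rpow1 S) => /Sk [_ x0].
  suff -> : x = 0 by exact: mem0v.
  by apply: coord0P => i id; rewrite x0 ?coord0_0 //; lia.
(* the range consists of the vectors with vanishing 0-th coordinate, and the
   0-th basis vector lies in the domain *)
have -> : (rran S + rdom S)%VS = fullv.
  apply/eqP; rewrite eqEsubv subvf; apply/subvP => x _.
  pose f i := if i == 0%N then 0 else coord0 x i.
  pose f' i := if i == 0%N then coord0 x 0 else 0.
  have -> : x = \col_(i < g.-1) f i + \col_(i < g.-1) f' i.
    apply: coord0P => i id; rewrite coord0D !coord0_col id /f /f'.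
    by case: eqP => [->|_]; rewrite ?add0r ?addr0.
  apply: memv_add.
    by rewrite -[S]rpow1; apply/ranP => -[|//] _; rewrite coord0_col if_same.
  apply/mem_rdom; pose h i := if (0 < i)%N then f' i.-1 else 0.
  exists (\col_(i < g.-1) h i); rewrite -[S]rpow1; apply/Sk; split=> i id.
    rewrite !coord0_col id /h subn1; case: ltnP => // i0.
    by rewrite (_ : (_ < _)%N) //; lia.
  rewrite coord0_col; case: ifP => // _; rewrite /f'; case: eqP => // i0; lia.
have := ranS 1%N; rewrite rpow1 => ran1.
by rewrite dim_quotE ?subvf // ran1 dimvf dim_matrix [(_ * 1)%R]muln1; lia.
Qed.

End KroneckerBlocks.

(** * Assembling the Kronecker form *)

Section KroneckerForm.
Variable K : fieldType.

Lemma sum_indicator (s : seq nat) k :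
  sumn [seq (k <= t)%N : nat | t <- s] = count (fun i => k <= i)%N s.
Proof. by elim: s => //= t s ->. Qed.

Lemma diag2_pencil n1 m1 n2 m2 (E1 F1 : 'M[K]_(n1, m1)) (E2 F2 : 'M_(n2, m2))
    s :
  diag2_mx (s *: E1 - F1) (s *: E2 - F2) =
  s *: diag2_mx E1 E2 - diag2_mx F1 F2.
Proof.
by rewrite /diag2_mx scale_block_mx opp_block_mx add_block_mx !scaler0 !subr0.
Qed.

Lemma kronecker_mxE js alpha beta gamma (s : K) :
  kronecker_mx js alpha beta gamma s =
  s *: diag2_mx 1%:M (diag2_mx (nilp_mx K alpha)
         (diag2_mx (K_mx K beta) (K_mx K gamma)^T)) -
  diag2_mx (jordan_mx js) (diag2_mx 1%:M
         (diag2_mx (L_mx K beta) (L_mx K gamma)^T)).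
Proof. by rewrite /kronecker_mx -[s%:M]scalemx1 !diag2_pencil. Qed.

(** The values at 0 and 1 determine a pencil. *)
Lemma pencil_inj n m (E F E' F' : 'M[K]_(n, m)) :
  (forall s, pencil E F s = s *: E' - F') -> E = E' /\ F = F'.
Proof.
move=> EF; have := EF 0; have := EF 1.
rewrite /pencil !scale1r !scale0r !sub0r => + /oppr_inj FF.
by rewrite FF => /addIr.
Qed.

Lemma Weyr_kronecker n m (E F : 'M[K]_(n, m)) js alpha beta gamma :
  kronecker_form E F js alpha beta gamma ->
  Weyr_numbers (kernel_relation E F)
    (fun lam k => \dim (mx_ker ((jordan_mx js - lam%:M) ^+ k)) -
                  \dim (mx_ker ((jordan_mx js - lam%:M) ^+ k.-1)))%N
    (fun k => count (fun i => k <= i)%N alpha)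
    (fun k => count (fun i => k <= i)%N beta)
    (fun k => count (fun i => k.+2 <= i)%N gamma).
Proof.
case=> _ _ _ _ [en [em [V [U [Vu Uu VU]]]]].
subst n m; have [s|VEU VFU] := @pencil_inj _ _ (V *m E *m U) (V *m F *m U)
  (diag2_mx 1%:M (diag2_mx (nilp_mx K alpha)
     (diag2_mx (K_mx K beta) (K_mx K gamma)^T)))
  (diag2_mx (jordan_mx js) (diag2_mx 1%:M
     (diag2_mx (L_mx K beta) (L_mx K gamma)^T))).
  rewrite -kronecker_mxE -VU castmx_id /pencil mulmxBr mulmxBl.
  by rewrite -scalemxAr -scalemxAl.
have wN := Weyr_diag_blocks alpha (@Weyr_nilp_block K).
rewrite -scalar_mx_diag_blocks in wN.
have wKL := Weyr_diag_blocks beta (@Weyr_KL_block K).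
have wT := Weyr_diag_blocks gamma (@Weyr_trKL_block K).
rewrite -!tr_diag_blocks in wT.
have wKLT := Weyr_diag2 (unitmx1 _ _) (unitmx1 _ _)
  (etrans (mulmx1 _) (mul1mx _))
  (etrans (mulmx1 _) (mul1mx _)) wKL wT.
have wNKLT := Weyr_diag2 (unitmx1 _ _) (unitmx1 _ _)
  (etrans (mulmx1 _) (mul1mx _))
  (etrans (mulmx1 _) (mul1mx _)) wN wKLT.
apply: Weyr_numbers_ext (Weyr_diag2 Vu Uu VEU VFU (Weyr_jordan _) wNKLT) _.
have sum0 s : sumn [seq 0%N | _ <- s : seq nat] = 0%N by elim: s.
move=> k _; rewrite !sum0 !addn0 !add0n !sum_indicator.
by split=> // lam; rewrite addn0.
Qed.

Lemma mx_ker_neq0 m (M : 'M[K]_m) : mx_ker M <> 0%VS <-> M \notin unitmx.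
Proof.
split=> [ker0|].
  apply/negP => Mu; apply: ker0; apply/eqP; rewrite -subv0; apply/subvP => x.
  by move=> /mem_mx_ker Mx; rewrite -[x](mulKmx Mu) Mx mulmx0 mem0v.
rewrite -unitmx_tr -row_free_unit => /negP Mt ker0; apply: Mt.
apply/inj_row_free => v vM; apply: trmx_inj; rewrite trmx0.
apply/eqP; rewrite -memv0 -ker0; apply/mem_mx_ker.
by rewrite -[M]trmxK -trmx_mul vM trmx0.
Qed.

Lemma eigenvalue_kernel_dimsP m (J : 'M[K]_m) lam :
  eigenvalue J lam <-> exists2 k, (0 < k)%N &
    (\dim (mx_ker ((J - lam%:M) ^+ k)) -
     \dim (mx_ker ((J - lam%:M) ^+ k.-1)))%N <> 0%N.
Proof.
set M := J - lam%:M.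
have eigE : eigenvalue J lam = (M \notin unitmx).
  by rewrite /eigenvalue /eigenspace kermx_eq0 row_free_unit.
have ker1 : mx_ker (1%:M : 'M[K]_m) = 0%VS.
  apply/eqP; rewrite -subv0; apply/subvP => x /mem_mx_ker.
  by rewrite mul1mx => ->; apply: mem0v.
rewrite eigE -mx_ker_neq0; split=> [kerM|[k _ wk] kerM].
  exists 1%N => //; rewrite /= expr1 expr0 ker1 dimv0 subn0 => /eqP.
  by rewrite dimv_eq0 => /eqP.
apply: wk; suff -> : mx_ker (M ^+ k) = 0%VS by rewrite dimv0.
apply/eqP; rewrite -subv0; apply/subvP => x /mem_mx_ker.
rewrite memv0; elim: k => [|k IH]; first by rewrite mul1mx => ->.
rewrite exprS -[_ * _]/(_ *m _) -mulmxA => /mem_mx_ker.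
by rewrite kerM memv0 => /eqP.
Qed.

End KroneckerForm.

Theorem theorem5p1 (R : realType) (n m : nat) (E F : 'M[R[i]]_(n, m))
    (w : R[i] -> option (seq nat)) (a b c : seq nat) :
  pencil_Weyr E F w a b c ->
  [/\ relation_W (kernel_relation E F) = w,
      relation_A (kernel_relation E F) = a,
      relation_B (kernel_relation E F) = b &
      relation_C (kernel_relation E F) = drop 2 c].
Proof.
move=> [js [alpha [beta [gamma [/Weyr_kronecker wEF -> -> -> ->]]]]].
split; [|apply: omit_zeros_eq => k /wEF [_ ? ? _] //..|].
  apply/funext => lam; rewrite /relation_W /matrix_w.
  rewrite (_ : `[< _ >]%classic = eigenvalue (jordan_mx js) lam).
    by case: ifP => // _; congr Some; apply: omit_zeros_eq => k /wEF [-> _ _ _].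
  apply/asboolP/idP => [/proper_eigenvalueP|/eigenvalue_kernel_dimsP] [k k0 Wk].
    by apply/eigenvalue_kernel_dimsP; exists k => //; have [<- _ _ _] := wEF k k0.
  by apply/proper_eigenvalueP; exists k => //; have [-> _ _ _] := wEF k k0.
rewrite -omit_zeros_shift; first by apply: omit_zeros_eq => k /wEF [_ _ _ ->].
  by move=> k l kl; apply: sub_count => i; apply: leq_trans.
exact: count_eventually0.
Qed.
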